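(* Let $k$ be an algebraically closed field, let $\Delta$ be a translation quiver, and let $x,y \in \Delta_0$ be such that all the paths between $x$ and $y$ (i.e. from $x$ to $y$) are pairwise homotopic and closed. Suppose there is a path $x=x_0 \rightarrow x_1 \rightarrow \cdots \rightarrow x_n = y$ in $\Delta$. For all $1 \leq i \leq n$, let $\alpha_{i1},\ldots,\alpha_{id_i}$ be all the arrows from $x_{i-1}$ to $x_i$ in $\Delta$, and let $a_{ij} \in k$ ($1 \leq i \leq n$, $1 \leq j \leq d_i$) be scalars such that for every $i$ there is a $j$ with $a_{ij} \neq 0$. Define, for every $1 \leq i \leq n$, $h_i = a_{i1} \alpha_{i1} + \cdots + a_{id_i} \alpha_{id_i} \in k\Delta(x_{i-1},x_i)$, and let $\overline{h_i}$ be its class in the mesh category $k(\Delta)$. Then $\overline{h_n} \cdots \overline{h_1} \neq 0$ in $k(\Delta)$.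
   Context: A translation quiver $\Delta$ is a quiver without loops (vertices $\Delta_0$, arrows $\Delta_1$), with a partially defined map $\tau$ on vertices (vertices outside the domain of $\tau$ are called projective, those outside its range injective) which is a bijection from non-projective to non-injective vertices, and, for all vertices $u,v$ with $u$ non-projective, a bijection $\sigma$ from arrows $v\to u$ to arrows $\tau u\to v$. All translation quivers are locally finite: finitely many arrows start, and finitely many end, at each vertex. Paths are composed right to left, with a trivial path $\epsilon_v$ of length $0$ at each vertex $v$. A vertex $v$ is an immediate successor of $u$ if there is an arrow $u\to v$. A path $x_0\to x_1\to\cdots\to x_m$ is closed if, whenever $0\le i\le m-2$ and $x_i=\tau x_{i+2}$, the vertex $x_i$ has at least two immediate successors. Homotopy. To each arrow $\alpha$ is associated a formal inverse $\alpha^{-1}$ with start and end swapped. A walk is a composable sequence $\beta_n\cdots\beta_1$ of arrows or inverses of arrows (the start of $\beta_i$ equals the end of $\beta_{i-1}$), or a trivial walk $\epsilon_v$. Homotopy $\sim$ is the smallest equivalence relation on walks such that: (a) for each arrow $\alpha:u\to v$, $\alpha\alpha^{-1}\sim\epsilon_v$ and $\alpha^{-1}\alpha\sim\epsilon_u$; (b) if $u$ is non-projective and $\alpha:z\to u$, $\alpha':z'\to u$ are arrows, then $\alpha(\sigma\alpha)\sim\alpha'(\sigma\alpha')$; (c) if $\gamma\sim\gamma'$ and $\gamma_1\gamma\gamma_2$, $\gamma_1\gamma'\gamma_2$ are defined, then $\gamma_1\gamma\gamma_2\sim\gamma_1\gamma'\gamma_2$; (d) any two arrows with the same start and the same end are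 homotopic. The path category $k\Delta$ has as objects the vertices of $\Delta$ and as morphisms $u\to v$ the formal $k$-linear combinations $k\Delta(u,v)$ of paths from $u$ to $v$. The mesh category $k(\Delta)$ is the quotient of $k\Delta$ by the ideal generated by all mesh relations $m_z=\sum_{\alpha}(\sigma^{-1}\alpha)\alpha$ (sum over all arrows $\alpha$ starting at $z$), with $z$ running through the non-injective vertices of $\Delta$. *)

(* Defs.v *)
From HB Require Import structures.
From mathcomp Require Import all_boot all_order all_algebra.
From mathcomp Require Import finmap boolp.
From mathcomp.multinomials Require Import monalg.

Set Implicit Arguments.
Unset Strict Implicit.
Unset Printing Implicit Defensive.

Import GRing.Theory.
Local Open Scope ring_scope.
Local Open Scope quotient_scope.

(* The paths of a quiver with vertices V and arrow sets E u v. Paths compose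
   from right to left: qcons a p is the path a p, in which p comes first. *)
Inductive qpath (V : Type) (E : V -> V -> Type) (u : V) : V -> Type :=
| qnil : qpath E u u
| qcons (v w : V) (a : E v w) (p : qpath E u v) : qpath E u w.

Arguments qnil {V E} u.
Arguments qcons {V E u v w} a p.

HB.instance Definition _ (V : Type) (E : V -> V -> Type) (u v : V) :=
  gen_eqMixin (qpath E u v).
HB.instance Definition _ (V : Type) (E : V -> V -> Type) (u v : V) :=
  gen_choiceMixin (qpath E u v).

Section QPath.
Variables (V : Type) (E : V -> V -> Type).

Definition qarrow (u v : V) (a : E u v) : qpath E u v := qcons a (qnil u).

Fixpoint qcomp (u v w : V) (q : qpath E v w) (p : qpath E u v) : qpath E u w :=
  match q in qpath _ _ w' return qpath E u w' with
  | qnil => p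
  | qcons _ _ a q' => qcons a (qcomp q' p)
  end.

Fixpoint qlength (u v : V) (p : qpath E u v) : nat :=
  if p is qcons _ _ _ p' then (qlength p').+1 else 0%N.

Fixpoint qvertices (u v : V) (p : qpath E u v) : seq V :=
  if p is qcons _ w _ p' then rcons (qvertices p') w else [:: u].

Lemma qcompA (u v w z : V)
    (r : qpath E w z) (q : qpath E v w) (p : qpath E u v) :
  qcomp r (qcomp q p) = qcomp (qcomp r q) p.
Proof. by elim: r => //= x y a r ->. Qed.

Lemma qcomp1p (u v : V) (p : qpath E u v) : qcomp (qnil v) p = p.
Proof. by []. Qed.

Lemma qcompp1 (u v : V) (p : qpath E u v) : qcomp p (qnil u) = p.
Proof. by elim: p => //= x y a p ->. Qed.

End QPath.

(* The partial map tau is defined at u when tau u = Some z; tau_inj says that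
   it is a bijection from its domain (the non-projective vertices) onto its
   range (the non-injective vertices). For non-projective u, with
   translate z, sigma is a bijection with inverse sigmaV. Local finiteness is
   carried by the finite types arrow u v together with the finite
   duplicate-free lists of immediate successors and predecessors. *)
Record translation_quiver := TranslationQuiver {
  vertex :> choiceType;
  arrow : vertex -> vertex -> finType;
  no_loop : forall u, arrow u u -> False;
  succs : vertex -> seq vertex;
  preds : vertex -> seq vertex;
  succs_uniq : forall u, uniq (succs u);
  preds_uniq : forall u, uniq (preds u);
  mem_succs : forall u v, (v \in succs u) = (0 < #|arrow u v|)%N;
  mem_preds : forall u v, (v \in preds u) = (0 < #|arrow v u|)%N;
  tau : vertex -> option vertex;
  tau_inj : forall u u' z, tau u = Some z -> tau u' = Some z -> u = u';
  sigma : forall u z v, tau u = Some z -> arrow v u -> arrow z v;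
  sigmaV : forall u z v, tau u = Some z -> arrow z v -> arrow v u;
  sigmaK : forall u z v (uz : tau u = Some z),
    cancel (@sigma u z v uz) (@sigmaV u z v uz);
  sigmaVK : forall u z v (uz : tau u = Some z),
    cancel (@sigmaV u z v uz) (@sigma u z v uz)
}.

Section Homotopy.
Variable Delta : translation_quiver.
Implicit Types u v w z : Delta.

Definition tqpath u v := qpath (@arrow Delta) u v.

Definition closed_path u v (p : tqpath u v) :=
  let x i := nth u (qvertices p) i in
  forall i, (i.+2 <= qlength p)%N ->
    tau (x i.+2) = Some (x i) -> (2 <= size (succs (x i)))%N.

(* A step from u to v of a walk is an arrow u -> v, or the formal inverse of
   an arrow v -> u. *)
Definition step u v : Type := (arrow u v + arrow v u)%type.

Definition walk u v := qpath step u v.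

Definition warrow u v (a : arrow u v) : walk u v := @qarrow _ step u v (inl a).

Definition winv u v (a : arrow u v) : walk v u := @qarrow _ step v u (inr a).

Fixpoint walk_of u v (p : tqpath u v) : walk u v :=
  match p in qpath _ _ v' return walk u v' with
  | qnil => qnil u
  | qcons _ _ a p' => qcomp (warrow a) (walk_of p')
  end.

Inductive homotopic : forall u v, walk u v -> walk u v -> Prop :=
| homotopic_refl u v (g : walk u v) : homotopic g g
| homotopic_sym u v (g h : walk u v) : homotopic g h -> homotopic h g
| homotopic_trans u v (g h l : walk u v) :
    homotopic g h -> homotopic h l -> homotopic g l
| homotopic_invr u v (a : arrow u v) :
    homotopic (qcomp (warrow a) (winv a)) (qnil v)
| homotopic_invl u v (a : arrow u v) :
    homotopic (qcomp (winv a) (warrow a)) (qnil u)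
| homotopic_mesh u t z z' (ut : tau u = Some t)
    (a : arrow z u) (a' : arrow z' u) :
    homotopic (qcomp (warrow a) (warrow (sigma ut a)))
              (qcomp (warrow a') (warrow (sigma ut a')))
| homotopic_comp u v w z (g1 : walk w z) (g g' : walk v w) (g2 : walk u v) :
    homotopic g g' ->
    homotopic (qcomp g1 (qcomp g g2)) (qcomp g1 (qcomp g' g2))
| homotopic_parallel u v (a b : arrow u v) : homotopic (warrow a) (warrow b).

End Homotopy.

(* << c *g p >> is the path p with coefficient c, and << p >> is << 1 *g p >> *)
Notation kpaths k u v := {malg k[tqpath u v]}.

Section PathCategory.
Variables (k : fieldType) (Delta : translation_quiver).
Implicit Types u v w z : Delta.

Local Notation kpath u v := (kpaths k u v).

Definition kid u : kpath u u := << qnil u >>.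

Definition kcomp u v w (g : kpath v w) (f : kpath u v) : kpath u w :=
  \sum_(q <- msupp g) \sum_(p <- msupp f) << g@_q * f@_p *g qcomp q p >>.

Definition mesh u z (uz : tau u = Some z) : kpath z u :=
  \sum_(v <- succs z) \sum_(a : arrow z v)
    << qcomp (qarrow (sigmaV uz a)) (qarrow a) >>.

Lemma kcompEw u v w (g : kpath v w) (f : kpath u v)
    (dg : {fset tqpath v w}) (df : {fset tqpath u v}) :
  (msupp g `<=` dg)%fset -> (msupp f `<=` df)%fset ->
  kcomp g f = \sum_(q <- dg) \sum_(p <- df) << g@_q * f@_p *g qcomp q p >>.
Proof.
move=> sg sf; rewrite /kcomp (big_fset_incl _ sg) /=; last first.
  move=> q _ /mcoeff_outdom gq; rewrite big1 // => p _.
  by rewrite gq mul0r monalgU0.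
apply/eq_bigr => q _; apply/big_fset_incl => // p _ /mcoeff_outdom ->.
by rewrite mulr0 monalgU0.
Qed.

Lemma kcompDl u v w (g g' : kpath v w) (f : kpath u v) :
  kcomp (g + g') f = kcomp g f + kcomp g' f.
Proof.
have sf := fsubset_refl (msupp f).
rewrite [in RHS](kcompEw (fsubsetUl _ (msupp g')) sf).
rewrite [in RHS](kcompEw (fsubsetUr (msupp g) _) sf).
rewrite (kcompEw (msuppD_le _ _) sf) -big_split; apply/eq_bigr => q _ /=.
rewrite -big_split; apply/eq_bigr => p _ /=.
by rewrite mcoeffD mulrDl monalgUD.
Qed.

Lemma kcompDr u v w (g : kpath v w) (f f' : kpath u v) :
  kcomp g (f + f') = kcomp g f + kcomp g f'.
Proof.
have sg := fsubset_refl (msupp g).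
rewrite [in RHS](kcompEw sg (fsubsetUl _ (msupp f'))).
rewrite [in RHS](kcompEw sg (fsubsetUr (msupp f) _)).
rewrite (kcompEw sg (msuppD_le _ _)) -big_split; apply/eq_bigr => q _ /=.
rewrite -big_split; apply/eq_bigr => p _ /=.
by rewrite mcoeffD mulrDr monalgUD.
Qed.

Lemma kcompBl u v w (g g' : kpath v w) (f : kpath u v) :
  kcomp (g - g') f = kcomp g f - kcomp g' f.
Proof. by apply/eqP; rewrite eq_sym subr_eq -kcompDl subrK. Qed.

Lemma kcompBr u v w (g : kpath v w) (f f' : kpath u v) :
  kcomp g (f - f') = kcomp g f - kcomp g f'.
Proof. by apply/eqP; rewrite eq_sym subr_eq -kcompDr subrK. Qed.

Lemma kcompUU u v w (c d : k) (q : tqpath v w) (p : tqpath u v) :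
  kcomp (<< c *g q >> : kpath v w) (<< d *g p >> : kpath u v) =
    << c * d *g qcomp q p >>.
Proof. by rewrite (kcompEw msuppU_le msuppU_le) !big_seq_fset1 !mcoeffUU. Qed.

Record category_ideal (I : forall u v, kpath u v -> Prop) : Prop := {
  category_ideal0 : forall u v, I u v 0;
  category_idealD : forall u v (f g : kpath u v),
    I u v f -> I u v g -> I u v (f + g);
  category_idealZ : forall u v (c : k) (f : kpath u v),
    I u v f -> I u v (c *: f);
  category_ideal_compl : forall u v w (g : kpath v w) (f : kpath u v),
    I u v f -> I u w (kcomp g f);
  category_ideal_compr : forall u v w (g : kpath v w) (f : kpath u v),
    I v w g -> I u w (kcomp g f)
}.

Definition in_mesh_ideal u v (f : kpath u v) : Prop :=
  forall I : (forall u v, kpath u v -> Prop), category_ideal I ->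
    (forall u z (uz : tau u = Some z), I z u (mesh uz)) -> I u v f.

Lemma in_mesh_ideal_ideal : category_ideal in_mesh_ideal.
Proof.
split=> [u v|u v f g If Ig|u v c f If|u v w g f If|u v w g f Ig] I idI meshI.
- exact: category_ideal0.
- by apply: category_idealD => //; [apply: If | apply: Ig].
- by apply: category_idealZ => //; apply: If.
- by apply: category_ideal_compl => //; apply: If.
- by apply: category_ideal_compr => //; apply: Ig.
Qed.

Definition mesh_ideal u v : {pred kpath u v} :=
  [pred f | `[< in_mesh_ideal f >]].
Arguments mesh_ideal u v : clear implicits.

Lemma mesh_idealP u v (f : kpath u v) :
  reflect (in_mesh_ideal f) (f \in mesh_ideal u v).
Proof. exact: asboolP. Qed.

Lemma mesh_ideal_zmod_closed u v : zmod_closed (mesh_ideal u v).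
Proof.
split=> [|f g /mesh_idealP If /mesh_idealP Ig]; apply/mesh_idealP.
  exact: (category_ideal0 in_mesh_ideal_ideal).
rewrite -scaleN1r; apply: (category_idealD in_mesh_ideal_ideal) => //.
exact: (category_idealZ in_mesh_ideal_ideal).
Qed.

HB.instance Definition _ u v :=
  GRing.isZmodClosed.Build (kpath u v) (mesh_ideal u v)
    (mesh_ideal_zmod_closed u v).

(* The mesh category k(Delta): the quotients of the k Delta(u, v) by the mesh
   ideal, with the composition induced by that of k Delta. *)
Definition meshhom u v := Quotient.quot (mesh_ideal u v).
HB.instance Definition _ u v := GRing.Zmodule.on (meshhom u v).

Definition mesh_class u v (f : kpath u v) : meshhom u v := \pi f.

Definition mesh_id u : meshhom u u := mesh_class (kid u).

Definition mesh_comp u v w (g : meshhom v w) (f : meshhom u v) : meshhom u w :=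
  mesh_class (kcomp (repr g) (repr f)).

Lemma mesh_class_eq u v (f g : kpath u v) :
  (mesh_class f = mesh_class g) <-> in_mesh_ideal (f - g).
Proof.
rewrite /mesh_class; split=> [/eqP|/mesh_idealP].
  by rewrite -Quotient.idealrBE => /mesh_idealP.
by rewrite Quotient.idealrBE => /eqP.
Qed.

Lemma mesh_comp_class u v w (g : kpath v w) (f : kpath u v) :
  mesh_comp (mesh_class g) (mesh_class f) = mesh_class (kcomp g f).
Proof.
have reprI x y (h : kpath x y) : in_mesh_ideal (repr (mesh_class h) - h).
  by apply/mesh_class_eq; rewrite /mesh_class reprK.
apply/mesh_class_eq.
set g' := repr _; set f' := repr _.
have -> : kcomp g' f' - kcomp g f = kcomp (g' - g) f' + kcomp g (f' - f).
  by rewrite kcompBl kcompBr addrA subrK.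
apply: (category_idealD in_mesh_ideal_ideal).
  by apply: (category_ideal_compr in_mesh_ideal_ideal); apply: reprI.
by apply: (category_ideal_compl in_mesh_ideal_ideal); apply: reprI.
Qed.

(* h_{n-1} ... h_1 h_0 *)
Fixpoint mesh_prod (x : nat -> Delta) (h : forall i, meshhom (x i) (x i.+1))
    (n : nat) : meshhom (x 0%N) (x n) :=
  if n is m.+1 then mesh_comp (h m) (mesh_prod h m) else mesh_id (x 0%N).

End PathCategory.

(* Main.v *)
Require Import Defs.
From mathcomp Require Import all_boot all_order all_algebra.
From mathcomp Require Import finmap boolp.
From mathcomp.multinomials Require Import monalg.

(* A linear functional on k Delta(x, y) separates the product from the mesh
   ideal. It sends a path a_{n-1} ... a_0 of length n to the product of weights
   c_i(a_i), and all paths of other lengths to 0. It kills the mesh ideal if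
   sum_a c_{i+1}(sigma^{-1} a) c_i(a) = 0 for every mesh that can occur at the
   steps i, i+1 of a path from x to y; its value on h_n ... h_1 is the product of
   the sum_j a_{i+1,j} c_i(alpha_{i+1,j}). The weights c_i are chosen by
   descending i: once c_{i+1} is known, the mesh relation at z is one linear
   equation in the values of c_i on the arrows starting at z. Since paths are
   closed, z has at least two immediate successors v, so the equation has a
   solution with nonzero contribution from each v, generic enough for the
   remaining sums not to vanish. *)

Set Implicit Arguments.
Unset Strict Implicit.
Unset Printing Implicit Defensive.

Import GRing.Theory.
Local Open Scope ring_scope.

(** * Scalars avoiding or solving linear equations *)

(** If neither the coordinate vector at [i] nor the one at [j] works, then [g i] and [f j] vanish,
    and the sum of the two vectors works. *)
Lemma common_nonzero (k : fieldType) (T : finType) (f g : T -> k) :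
    (exists i, f i != 0) -> (exists j, g j != 0) ->
  exists2 c : T -> k, \sum_i f i * c i != 0 & \sum_i g i * c i != 0.
Proof.
move=> [i fi] [j gj].
pose delta (l m : T) : k := (m == l)%:R.
have deltaE (e : T -> k) l : \sum_m e m * delta l m = e l.
  rewrite (bigD1 l) //= big1 => [|m /negPf ml]; rewrite /delta.
    by rewrite eqxx mulr1 addr0.
  by rewrite ml mulr0.
have [gi|gi] := eqVneq (g i) 0; last by exists (delta i); rewrite deltaE.
have [fj|fj] := eqVneq (f j) 0; last by exists (delta j); rewrite deltaE.
have sumE (e : T -> k) : \sum_m e m * (delta i m + delta j m) = e i + e j.
  by under eq_bigr do rewrite mulrDr; rewrite big_split /= !deltaE.
by exists (fun m => delta i m + delta j m); rewrite sumE ?fj ?addr0 ?gi ?add0r.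
Qed.

Lemma closed_field_third_element (k : closedFieldType) :
  exists2 r : k, r != 0 & r != 1.
Proof.
(* A root of X^2 - X - 1 is neither 0 nor 1, in any characteristic. *)
have [r] := @solve_monicpoly k 2 (fun=> 1) isT.
rewrite !big_ord_recl big_ord0 /= !mul1r expr0 addr0 => rE.
exists r; apply/eqP => r0; move/eqP: rE; rewrite r0.
  by rewrite expr0n expr1 addr0 eq_sym oner_eq0.
by rewrite !expr1n addrC -subr_eq subrr eq_sym oner_eq0.
Qed.

(** After division by [w v], only nonzero scalars with sum 0 are needed: two entries balance the
    others, which are set to 1. *)
Lemma rescale_sum_eq0 (k : closedFieldType) (T : eqType) (s : seq T)
    (w : T -> k) :
    uniq s -> (2 <= size s)%N -> (forall v, v \in s -> w v != 0) ->
  exists2 t : T -> k, forall v, v \in s -> t v != 0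
    & \sum_(v <- s) t v * w v = 0.
Proof.
case: s => [|v0 [|v1 s]] //= /and3P[]; rewrite inE negb_or.
move=> /andP[v01 v0s] v1s _ _ w0; set m : k := (size s)%:R.
(* The values at [v0] and [v1] will be [r] and [- (r + m)], so both must be nonzero. The choice
   [r = 1] fails only if [m = -1] in [k]; then any [r] other than 0 and 1 will do. *)
have [r r0 rm] : exists2 r : k, r != 0 & r + m != 0.
  have [m1|m1] := eqVneq (1 + m) 0; last by exists 1; rewrite ?oner_eq0.
  have [r r0 r1] := closed_field_third_element k; exists r => //.
  by rewrite (eqP (_ : m == -1)) ?subr_eq0 // -addr_eq0 addrC m1.
pose z v := if v == v0 then r else if v == v1 then - (r + m) else 1.
exists (fun v => z v / w v) => [v vs|].
  rewrite mulf_neq0 ?invr_eq0 ?w0 // /z.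
  by case: ifP => // _; case: ifP; rewrite ?oppr_eq0 ?oner_eq0.
rewrite (eq_big_seq z) => [|v vs]; last by rewrite divfK ?w0.
rewrite !big_cons /z eqxx (eq_sym v1) (negPf v01) eqxx.
rewrite (eq_big_seq (fun=> 1)) => [|v vs]; last first.
  case: ifP => [/eqP vE|_]; first by rewrite -vE vs in v0s.
  by case: ifP => // /eqP vE; rewrite -vE vs in v1s.
by rewrite big_const_seq count_predT iter_addr_0 -/m opprD !addrA subrr add0r
  addNr.
Qed.

(** * Linear functionals on spaces of paths *)

Section LinearExtension.
Variables (k : fieldType) (Delta : translation_quiver).
Implicit Types u v w : Delta.

Definition linext u v (F : tqpath u v -> k) (f : kpaths k u v) : k :=
  \sum_(p <- msupp f) f@_p * F p.

Lemma linextEw u v (F : tqpath u v -> k) (f : kpaths k u v)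
    (d : {fset tqpath u v}) :
  (msupp f `<=` d)%fset -> linext F f = \sum_(p <- d) f@_p * F p.
Proof.
move=> sf; apply: big_fset_incl => // p _ /mcoeff_outdom ->.
by rewrite mul0r.
Qed.

Lemma eq_linext u v (F G : tqpath u v -> k) : F =1 G -> linext F =1 linext G.
Proof. by move=> FG f; apply: eq_bigr => p _; rewrite FG. Qed.

Lemma linext0 u v (F : tqpath u v -> k) : linext F 0 = 0.
Proof. by rewrite /linext big1 // => p _; rewrite mcoeff0 mul0r. Qed.

Lemma linextD u v (F : tqpath u v -> k) (f g : kpaths k u v) :
  linext F (f + g) = linext F f + linext F g.
Proof.
rewrite (linextEw F (msuppD_le f g)).
rewrite (linextEw F (fsubsetUl (msupp f) (msupp g))).
rewrite (linextEw F (fsubsetUr (msupp f) (msupp g))) -big_split.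
by apply: eq_bigr => p _; rewrite mcoeffD mulrDl.
Qed.

Lemma linextZ u v (F : tqpath u v -> k) (c : k) (f : kpaths k u v) :
  linext F (c *: f) = c * linext F f.
Proof.
rewrite (linextEw F (msuppZ_le c f)) big_distrr.
by apply: eq_bigr => p _ /=; rewrite mcoeffZ mulrA.
Qed.

Lemma linextU u v (F : tqpath u v -> k) (c : k) (p : tqpath u v) :
  linext F (<< c *g p >> : kpaths k u v) = c * F p.
Proof. by rewrite (linextEw F msuppU_le) big_seq_fset1 mcoeffUU. Qed.

Lemma linext_sum u v (F : tqpath u v -> k) (I : Type) (r : seq I) (P : pred I)
    (f : I -> kpaths k u v) :
  linext F (\sum_(i <- r | P i) f i) = \sum_(i <- r | P i) linext F (f i).
Proof. exact: (big_morph _ (linextD F) (linext0 F)). Qed.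

Lemma linext_const0 u v (f : kpaths k u v) : linext (fun=> 0) f = 0.
Proof. by rewrite /linext big1 // => p _; rewrite mulr0. Qed.

Lemma linextMl u v (c : k) (F : tqpath u v -> k) (f : kpaths k u v) :
  linext (fun p => c * F p) f = c * linext F f.
Proof. by rewrite big_distrr; apply: eq_bigr => p _; rewrite /= mulrCA. Qed.

Lemma linext_kcomp u v w (F : tqpath u w -> k) (g : kpaths k v w)
    (f : kpaths k u v) :
  linext F (kcomp g f) = linext (fun q => linext (fun p => F (qcomp q p)) f) g.
Proof.
rewrite linext_sum; apply: eq_bigr => q _.
rewrite linext_sum big_distrr; apply: eq_bigr => p _.
by rewrite linextU /= mulrA.
Qed.

Lemma linext_kcompC u v w (F : tqpath u w -> k) (g : kpaths k v w)
    (f : kpaths k u v) :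
  linext F (kcomp g f) = linext (fun p => linext (fun q => F (qcomp q p)) g) f.
Proof.
rewrite linext_kcomp /linext; under eq_bigr do rewrite big_distrr.
rewrite exchange_big; apply: eq_bigr => p _.
by rewrite big_distrr; apply: eq_bigr => q _; rewrite /= mulrCA.
Qed.

(** The elements killed by [F] after composition with arbitrary paths on both sides form an ideal.
    It contains the mesh relations, hence the mesh ideal; trivial paths on both sides give back
    [F]. *)
Lemma linext_mesh_ideal x y (F : tqpath x y -> k) :
    (forall u z (uz : tau u = Some z) (q : tqpath u y) (p : tqpath x z),
      linext (fun r => F (qcomp q (qcomp r p))) (mesh k uz) = 0) ->
  forall f : kpaths k x y, in_mesh_ideal f -> linext F f = 0.
Proof.
move=> Fmesh f /(_ (fun u v g => forall (q : tqpath v y) (p : tqpath x u),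
  linext (fun r => F (qcomp q (qcomp r p))) g = 0)) IF.
rewrite -(IF _ _ (qnil y) (qnil x)) //.
  by apply: eq_linext => r; rewrite qcompp1.
split=> [u v|u v g h Ig Ih|u v c g Ig|u v w g h Ih|u v w g h Ig] q p.
- exact: linext0.
- by rewrite linextD Ig Ih addr0.
- by rewrite linextZ Ig mulr0.
- rewrite linext_kcomp -[RHS](linext_const0 g); apply: eq_linext => q'.
  rewrite -[RHS](Ih (qcomp q q') p); apply: eq_linext => r.
  by rewrite !qcompA.
rewrite linext_kcompC -[RHS](linext_const0 h); apply: eq_linext => p'.
rewrite -[RHS](Ig q (qcomp p' p)); apply: eq_linext => r.
by rewrite !qcompA.
Qed.

Fixpoint kprod (x_ : nat -> Delta) (h : forall i, kpaths k (x_ i) (x_ i.+1))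
    (n : nat) : kpaths k (x_ 0%N) (x_ n) :=
  if n is m.+1 then kcomp (h m) (kprod h m) else kid k (x_ 0%N).

Lemma mesh_prod_class (x_ : nat -> Delta)
    (h : forall i, kpaths k (x_ i) (x_ i.+1)) n :
  mesh_prod (fun i => mesh_class (h i)) n = mesh_class (kprod h n).
Proof. by elim: n => //= n ->; rewrite mesh_comp_class. Qed.

End LinearExtension.

(** * Lengths and vertices of composite paths *)

Section QPathTheory.
Variables (V : Type) (E : V -> V -> Type).

Lemma qlength_comp u v w (q : qpath E v w) (p : qpath E u v) :
  qlength (qcomp q p) = (qlength q + qlength p)%N.
Proof. by elim: q => //= x y a q ->. Qed.

Lemma size_qvertices u v (p : qpath E u v) :
  size (qvertices p) = (qlength p).+1.
Proof. by elim: p => //= x y a p; rewrite size_rcons => ->. Qed.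

Lemma nth_qvertices_last x0 u v (p : qpath E u v) :
  nth x0 (qvertices p) (qlength p) = v.
Proof.
by case: p => //= w z a p; rewrite nth_rcons size_qvertices ltnn eqxx.
Qed.

Lemma nth_qvertices_comp x0 u v w (q : qpath E v w) (p : qpath E u v) i :
  (i <= qlength p)%N ->
  nth x0 (qvertices (qcomp q p)) i = nth x0 (qvertices p) i.
Proof.
move=> ip; elim: q => //= y z a q IH.
rewrite nth_rcons size_qvertices qlength_comp ltnS.
by rewrite (leq_trans ip) ?leq_addl.
Qed.

End QPathTheory.

(** * The functional given by time-dependent arrow weights *)

Section PathWeight.
Variables (k : fieldType) (Delta : translation_quiver).
Implicit Types u v w : Delta.

Definition arrow_weight := forall u v, arrow u v -> k.

Variable c : nat -> arrow_weight.

(* The weight of a path traversed from time j on. *)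
Fixpoint path_weight j u v (p : tqpath u v) : k :=
  if p is qcons _ _ a p' then c (j + qlength p')%N a * path_weight j p' else 1.

Lemma path_weight_comp j u v w (q : tqpath v w) (p : tqpath u v) :
  path_weight j (qcomp q p) =
    path_weight (j + qlength p)%N q * path_weight j p.
Proof.
elim: q => /= [|y z a q IH]; first by rewrite mul1r.
by rewrite IH mulrA qlength_comp (addnC (qlength q)) addnA.
Qed.

(** Mesh relations are homogeneous of length 2, so the cut-off is compatible with them and only
    weights at times below [n] matter. *)
Definition truncated_weight n u v (p : tqpath u v) : k :=
  if qlength p == n then path_weight 0 p else 0.

Lemma linext_kprod (x_ : nat -> Delta)
    (a : forall i, arrow (x_ i) (x_ i.+1) -> k) n :
  linext (@truncated_weight n _ _)
      (kprod (fun i => \sum_alpha a i alpha *: << qarrow alpha >>) n) =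
    \prod_(i < n) \sum_alpha a i alpha * c i alpha.
Proof.
elim: n => [|n IH]; first by rewrite big_ord0 linextU mul1r.
rewrite big_ord_recr /= -IH linext_kcomp linext_sum mulrC big_distrl.
apply: eq_bigr => alpha _; rewrite linextZ linextU mul1r /= -mulrA.
congr (_ * _); rewrite -linextMl; apply: eq_linext => p.
rewrite /truncated_weight /= eqSS add0n.
by case: eqP => [->|_]; rewrite ?mulr0.
Qed.

Lemma truncated_weight_mesh n x y :
    (forall p : tqpath x y, closed_path p) ->
    (forall m u z (uz : tau u = Some z), (m.+1 < n)%N ->
      (2 <= size (succs z))%N ->
      \sum_(v <- succs z) \sum_(a : arrow z v) c m.+1 (sigmaV uz a) * c m a
        = 0) ->
  forall f : kpaths k x y, in_mesh_ideal f ->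
    linext (@truncated_weight n x y) f = 0.
Proof.
move=> hclosed c0; apply: linext_mesh_ideal => u z uz q p.
rewrite linext_sum; under eq_bigr => v _ do rewrite linext_sum.
have [len|len] := eqVneq (qlength q + (qlength p).+2)%N n; last first.
  rewrite big1 // => v _; rewrite big1 // => a _.
  by rewrite linextU /truncated_weight !qlength_comp /= (negPf len) mulr0.
have m1 : ((qlength p).+1 < n)%N by rewrite -len leq_addl.
(* Without successors of [z], the mesh relation is an empty sum. *)
have [s0|] := posnP (size (succs z)); first by rewrite (size0nil s0) big_nil.
rewrite -has_predT => /hasP[v]; rewrite mem_succs => /card_gt0P[a _] _.
(* One term of the mesh, placed between [p] and [q], is a path from [x] to [y] with [z] at position
   [qlength p] and [u] two steps later; its closedness applies. *)
have z2 : (2 <= size (succs z))%N.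
  have := hclosed (qcomp q (qcons (sigmaV uz a) (qcons a p))) (qlength p).
  rewrite qlength_comp /= leq_addl !nth_qvertices_comp ?(leqW (leqnSn _)) //=.
  rewrite !nth_rcons !size_rcons !size_qvertices.
  by rewrite ltnn eqxx ltnS leqnSn ltnSn nth_qvertices_last => /(_ isT uz).
(* All terms share the weights of [p] and [q]; what remains is the mesh sum at time [qlength p]. *)
transitivity (path_weight (qlength p).+2 q * path_weight 0 p *
    \sum_(v <- succs z) \sum_(b : arrow z v)
      c (qlength p).+1 (sigmaV uz b) * c (qlength p) b); last first.
  by rewrite c0 ?mulr0.
rewrite big_distrr; apply: eq_bigr => w _; rewrite big_distrr.
apply: eq_bigr => b _; rewrite linextU mul1r /truncated_weight.
rewrite !qlength_comp /= len eqxx path_weight_comp /= !add0n.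
by rewrite -!mulrA; congr (_ * _); rewrite mulrA mulrC.
Qed.

End PathWeight.

(** * Backward choice of the weights *)

Section WeightChoice.
Variables (k : closedFieldType) (Delta : translation_quiver).
Implicit Types u v w z : Delta.

(** Invariant of the recursion: each successor then contributes a nonzero linear form to the mesh
    equation one time step earlier. *)
Definition nonzero_weight (c : arrow_weight k Delta) :=
  forall u v, v \in succs u -> exists a : arrow u v, c u v a != 0.

(* Every arrow starting at z occurs in the mesh relation at z and in no
   other one as first arrow, so that the weights of the arrows out of z can be
   adjusted independently of all other vertices. *)
Lemma weight_step (c : arrow_weight k Delta) (x0 x1 : Delta)
    (f : arrow x0 x1 -> k) :
    nonzero_weight c -> (exists a, f a != 0) ->
  exists c' : arrow_weight k Delta,
    [/\ nonzero_weight c', \sum_a f a * c' x0 x1 a != 0 &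
      forall u z (uz : tau u = Some z), (2 <= size (succs z))%N ->
        \sum_(v <- succs z) \sum_(a : arrow z v) c v u (sigmaV uz a) * c' z v a
          = 0].
Proof.
move=> c_nz f_nz.
pose one (e : Delta * Delta) (a : arrow e.1 e.2) : k := 1.
(* With [f] at [(x0, x1)] and 1 elsewhere, nonvanishing of all sums against [g] yields both the
   required sum and the invariant for [c']. *)
pose g u v : arrow u v -> k := dfwith one (i := (x0, x1)) f (u, v).
have gE : g x0 x1 = f by rewrite /g dfwith_in.
have g_nz u v : v \in succs u -> exists a, g u v a != 0.
  rewrite mem_succs => /card_gt0P[a _]; rewrite /g.
  have [[<- <-]|ne] := eqVneq (x0, x1) (u, v); first by rewrite dfwith_in.
  by exists a; rewrite dfwith_out // oner_neq0.
have star z : exists c' : forall v, arrow z v -> k,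
    (forall v, v \in succs z -> \sum_a g z v a * c' v a != 0) /\
    forall u (uz : tau u = Some z), (2 <= size (succs z))%N ->
      \sum_(v <- succs z) \sum_(a : arrow z v) c v u (sigmaV uz a) * c' v a = 0.
  have both (b : forall v, arrow z v -> k) :
      (forall v, v \in succs z -> exists a, b v a != 0) ->
    exists c' : forall v, arrow z v -> k, forall v, v \in succs z ->
      \sum_a g z v a * c' v a != 0 /\ \sum_a b v a * c' v a != 0.
    move=> b_nz.
    have ex v : exists c' : arrow z v -> k, v \in succs z ->
        \sum_a g z v a * c' a != 0 /\ \sum_a b v a * c' a != 0.
      have [vz|_] := boolP (v \in succs z); last by exists (fun=> 0).
      by have [c' ? ?] := common_nonzero (g_nz _ _ vz) (b_nz _ vz); exists c'.
    by exists (fun v => sval (cid (ex v))) => v; apply: svalP (cid (ex v)).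
  (* If [z] is injective, there is no mesh equation at [z], and [g z] merely fills the second slot
     of [both]. *)
  have [[u uz]|no_u] := pselect (exists u, tau u = Some z); last first.
    have [c' c'P] := both (g z) (g_nz z); exists c'; split=> [v /c'P[]//|u uz].
    by case: no_u; exists u.
  have [v vz|c' c'P] := both (fun v a => c v u (sigmaV uz a)).
    have [|a ca] := c_nz v u.
      rewrite mem_succs; move: vz; rewrite mem_succs => /card_gt0P[a _].
      by apply/card_gt0P; exists (sigmaV uz a).
    by exists (sigma uz a); rewrite sigmaK.
  have [z2|z1] := leqP 2 (size (succs z)); last first.
    by exists c'; split=> [v /c'P[]|].
  have [|t t_nz t0] := rescale_sum_eq0 (succs_uniq z) z2
    (w := fun v => \sum_a c v u (sigmaV uz a) * c' v a).
    by move=> v /c'P[].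
  (* A common factor on all arrows from [z] to [v] keeps the sums against [g] nonzero while
     balancing the mesh equation. *)
  exists (fun v a => t v * c' v a); split=> [v vz|u' uz' _].
    under eq_bigr do rewrite mulrCA.
    by rewrite -big_distrr mulf_neq0 ?t_nz //; case: (c'P v vz).
  (* Injectivity of [tau] leaves a single mesh equation at [z]. *)
  have uu := tau_inj uz' uz; rewrite {u'}uu in uz' *.
  rewrite (eq_irrelevance uz' uz) -[RHS]t0; apply: eq_bigr => v _.
  by rewrite big_distrr; apply: eq_bigr => a _; rewrite /= mulrCA.
pose c' z := sval (cid (star z)).
have c'P z := svalP (cid (star z)).
exists c'; split=> [u v uv|| u z uz].
- have [/(_ v uv) sum_nz _] := c'P u; apply: contrapT => no_a.
  case/eqP: sum_nz; rewrite big1 // => a _.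
  have [c'0|nz] := eqVneq (c' u v a) 0; first by rewrite -/(c' u) c'0 mulr0.
  by case: no_a; exists a.
- have [+ _] := c'P x0 => /(_ x1); rewrite gE; apply.
  by rewrite mem_succs; case: f_nz => a _; apply/card_gt0P; exists a.
- by have [_] := c'P z; apply.
Qed.

Lemma weights_exist (x_ : nat -> Delta)
    (f : forall i, arrow (x_ i) (x_ i.+1) -> k) n :
    (forall i, (i < n)%N -> exists a, f i a != 0) ->
  exists c : nat -> arrow_weight k Delta,
    (forall i, (i < n)%N -> \sum_a f i a * c i _ _ a != 0) /\
    (forall m u z (uz : tau u = Some z), (m.+1 < n)%N ->
      (2 <= size (succs z))%N ->
      \sum_(v <- succs z) \sum_(a : arrow z v)
        c m.+1 _ _ (sigmaV uz a) * c m _ _ a = 0).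
Proof.
move=> f_nz.
have one_nz : nonzero_weight (fun _ _ _ => 1).
  move=> u v; rewrite mem_succs => /card_gt0P[a _].
  by exists a; apply: oner_neq0.
(* The guard [m < n] makes the step total: at other times the weight is kept. *)
have step m (c : {c | nonzero_weight c}) : exists c' : {c | nonzero_weight c},
    (m < n)%N -> \sum_a f m a * sval c' _ _ a != 0 /\
    forall u z (uz : tau u = Some z), (2 <= size (succs z))%N ->
      \sum_(v <- succs z) \sum_(a : arrow z v)
        sval c _ _ (sigmaV uz a) * sval c' _ _ a = 0.
  case: (ltnP m n) => [mn|_]; last by exists c.
  have [c' [c'_nz fc' cc']] := weight_step (svalP c) (f_nz m mn).
  by exists (exist _ c' c'_nz).
pose next m c := sval (cid (step m c)).
have nextP m c := svalP (cid (step m c)).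
(* r j is the weight at time n - j: the weights are chosen backwards in time. *)
pose r := fix r j := if j is i.+1 then next (n - j)%N (r i)
                     else exist _ (fun _ _ _ => 1) one_nz.
have rE m : (m < n)%N -> r (n - m)%N = next m (r (n - m.+1)%N).
  move=> mn; rewrite subnS; case E: (n - m)%N => [|j] /=.
    by rewrite -subn_gt0 E in mn.
  by rewrite -E subKn // ltnW.
exists (fun m => sval (r (n - m)%N)); split=> [i lt_in|m u z uz m1 z2].
  by rewrite rE //; case: (nextP i (r (n - i.+1)%N) lt_in).
have mn := ltnW m1; rewrite (rE m) //.
by have [_] := nextP m (r (n - m.+1)%N) mn; apply.
Qed.

End WeightChoice.

Theorem theorem5p1 (k : closedFieldType) (Delta : translation_quiver)
    (x y : Delta)
    (hhomotopic : forall p q : tqpath x y, homotopic (walk_of p) (walk_of q))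
    (hclosed : forall p : tqpath x y, closed_path p)
    (n : nat) (x_ : nat -> Delta) (hx0 : x_ 0%N = x) (hxn : x_ n = y)
    (hpath : forall i, (i < n)%N -> x_ i.+1 \in succs (x_ i))
    (a : forall i, arrow (x_ i) (x_ i.+1) -> k)
    (ha : forall i, (i < n)%N -> exists alpha, a i alpha != 0) :
  let h i : kpaths k (x_ i) (x_ i.+1) :=
    \sum_(alpha : arrow (x_ i) (x_ i.+1)) a i alpha *: << qarrow alpha >> in
  mesh_prod (fun i => mesh_class (h i)) n != 0.
Proof.
have [c [ac cc]] := weights_exist ha.
(* The product is lifted to [g] in the path category, where the functional can be evaluated. *)
rewrite /= mesh_prod_class; set g := kprod _ n.
case: _ / hx0 hclosed {hhomotopic} => hclosed.
case: _ / hxn hclosed => hclosed.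
have g_nz : linext (@truncated_weight _ _ c n _ _) g != 0.
  by rewrite linext_kprod prodf_seq_neq0; apply/allP => i _; apply: ac.
apply: contraNneq g_nz => g0; apply/eqP/truncated_weight_mesh => //.
by rewrite -[g]subr0; apply/mesh_class_eq; rewrite g0 /mesh_class raddf0.
Qed.
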